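(* Let $(G,M)$ be a marked permutation graph with $n\geq 40$ vertices such that $G$ contains no $M$-copy of $C_4$. Then $G$ contains at least $n/2-4$ $M$-copies of $P_{10}$.
   Context: Graphs are finite. $P_{10}$ denotes the Petersen graph and $C_4$ the 4-cycle. A marked permutation graph is a pair $(G,M)$ where $G$ is a cubic graph and $M$ is a perfect matching of $G$ (a distinguished matching) such that $G-E(M)$ is the disjoint union of two cycles, neither of which has a chord in $G$. An $M$-copy of $P_{10}$ is a subgraph of $G$ that is isomorphic to a subdivision of $P_{10}$ and is composed of the two cycles of $G-E(M)$ together with five edges of $M$. An $M$-copy of $C_4$ is a 4-cycle in $G$ that uses two edges of $M$. The $M$-copies are counted as distinct subgraphs of $G$ (equivalently, by the set of five edges of $M$ used). *)

(* Defs.v *)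
From HB Require Import structures.
From mathcomp Require Import all_boot.

Set Implicit Arguments.
Unset Strict Implicit.
Unset Printing Implicit Defensive.

(* Finite simple graphs whose vertices are taken from an ambient finite type T.
   All graphs on subsets of T share one type, so that a graph and its subgraphs
   can be compared, and subgraphs counted as elements of a finite type. *)
Definition graph_axiom (T : finType) (VE : {set T} * {set {set T}}) : bool :=
  [forall e in VE.2, (#|e| == 2) && (e \subset VE.1)].

Record graph (T : finType) := Graph {
  graph_val : {set T} * {set {set T}};
  graph_valP : graph_axiom graph_val }.

HB.instance Definition _ (T : finType) := [isSub for @graph_val T].
HB.instance Definition _ (T : finType) := [Finite of graph T by <:].

Definition verts (T : finType) (G : graph T) : {set T} := (graph_val G).1.
Definition edges (T : finType) (G : graph T) : {set {set T}} :=
  (graph_val G).2.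

Definition subgraph (T : finType) (H G : graph T) : bool :=
  (verts H \subset verts G) && (edges H \subset edges G).

Definition isomorphic (T U : finType) (G : graph T) (H : graph U) : Prop :=
  exists2 f : {x | x \in verts G} -> {y | y \in verts H}, bijective f &
    forall x y, ([set val x; val y] \in edges G)
              = ([set val (f x); val (f y)] \in edges H).

(* G' arises from G by inserting the new vertex z in the middle of the
   edge xy. *)
Definition subdivide_edge (T : finType) (G G' : graph T) (x y z : T) : Prop :=
  [/\ [set x; y] \in edges G, z \notin verts G,
      verts G' = z |: verts G &
      edges G' = [set x; z] |: ([set z; y] |: edges G :\ [set x; y])].

Inductive subdivision (T : finType) (G : graph T) : graph T -> Prop :=
| subdivision_refl : subdivision G G
| subdivision_step (H H' : graph T) (x y z : T) :
    subdivision G H -> subdivide_edge H H' x y z -> subdivision G H'.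

(* H is isomorphic to a subdivision of P; the isomorphism is applied before
   the subdivision because P may live in a type too small to subdivide in. *)
Definition isomorphic_to_subdivision (T U : finType) (H : graph T)
    (P : graph U) : Prop :=
  exists2 P' : graph T, isomorphic P P' & subdivision P' H.

(* The Petersen graph as two 5-cycles joined by spokes: (false, i) is the i-th
   vertex of the outer pentagon, (true, i) the i-th one of the inner
   pentagram. *)
Definition petersen_adj (x y : bool * 'I_5) : bool :=
  match x, y with
  | (false, i), (false, j) => j == i.+1 %% 5 :> nat
  | (true, i), (true, j) => j == i.+2 %% 5 :> nat
  | (false, i), (true, j) => i == j
  | (true, _), (false, _) => false
  end.

Definition petersen_edges : {set {set bool * 'I_5}} :=
  [set [set xy.1; xy.2] | xy in [set xy : (bool * 'I_5) * (bool * 'I_5) |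
                                 petersen_adj xy.1 xy.2]].

Lemma petersen_axiom : graph_axiom ([set: bool * 'I_5], petersen_edges).
Proof.
apply/forall_inP=> e /imsetP[[x y]]; rewrite inE /= => adj_xy ->.
rewrite subsetT andbT cards2; suff -> : x != y by [].
apply/eqP=> eq_xy; move: adj_xy; rewrite -{y}eq_xy.
by case: x => -[] [[|[|[|[|[|i]]]]] lt_i5].
Qed.

Definition petersen : graph (bool * 'I_5)%type := Graph petersen_axiom.

Lemma delete_edges_axiom (T : finType) (G : graph T) (F : {set {set T}}) :
  graph_axiom (verts G, edges G :\: F).
Proof.
apply/forall_inP=> e /setDP[eG _].
by have /forall_inP/(_ e eG) := graph_valP G.
Qed.

Definition delete_edges (T : finType) (G : graph T) (F : {set {set T}}) :
  graph T := Graph (delete_edges_axiom G F).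

Definition cubic (T : finType) (G : graph T) : Prop :=
  forall x, x \in verts G -> #|[set e in edges G | x \in e]| = 3.

Definition perfect_matching (T : finType) (G : graph T)
    (M : {set {set T}}) : Prop :=
  M \subset edges G /\ partition M (verts G).

Definition is_cycle (T : finType) (C : graph T) : Prop :=
  exists s : seq T,
    [/\ uniq s, 2 < size s, verts C = [set x in s] &
        edges C = [set [set x; next s x] | x in s]].

Definition disjoint_union (T : finType) (G G1 G2 : graph T) : Prop :=
  [/\ [disjoint verts G1 & verts G2], verts G = verts G1 :|: verts G2 &
      edges G = edges G1 :|: edges G2].

Definition is_chord (T : finType) (G C : graph T) (e : {set T}) : bool :=
  [&& e \in edges G, e \notin edges C & e \subset verts C].

Definition chordless (T : finType) (G C : graph T) : Prop :=
  forall e : {set T}, ~~ is_chord G C e.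

Definition marked_permutation_graph (T : finType) (G : graph T)
    (M : {set {set T}}) : Prop :=
  [/\ cubic G, perfect_matching G M &
      exists C1 C2 : graph T,
        [/\ is_cycle C1, is_cycle C2,
            disjoint_union (delete_edges G M) C1 C2,
            chordless G C1 & chordless G C2]].

(* For a marked permutation graph, delete_edges G M is the union of the two
   cycles. *)
Definition M_copy_P10 (T : finType) (G : graph T) (M : {set {set T}})
    (H : graph T) : Prop :=
  [/\ subgraph H G, isomorphic_to_subdivision H petersen &
      exists F : {set {set T}},
        [/\ F \subset M, #|F| = 5, verts H = verts (delete_edges G M) &
            edges H = edges (delete_edges G M) :|: F]].

Definition M_copy_C4 (T : finType) (G : graph T) (M : {set {set T}})
    (C : graph T) : Prop :=
  [/\ subgraph C G, is_cycle C, #|verts C| = 4 & #|edges C :&: M| = 2].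

(* Main.v *)
Require Import Defs.
From mathcomp Require Import all_boot zify.

Set Implicit Arguments.
Unset Strict Implicit.
Unset Printing Implicit Defensive.

(** Let s1 and s2 list the two cycles of G - E(M).  Since the cycles have no
    chord, every edge of M joins s1 to s2, so M carries two cyclic orders, one
    for each cycle, recorded by the positions p and q of the ends of its edges.
    In these terms an M-copy of C_4 is a pair of twins, that is, two edges of M
    which are neighbours in both cyclic orders, and a set of five edges of M
    spans an M-copy of P_10 as soon as it is a pentagram: q visits it in steps
    of two or of three with respect to p ([pentagram_copy]).

    The count is an induction on a set A of edges of M.  Call an element e of A
    pinning if every pair of twins of A contains e; when there are no twins any
    element is pinning.

    Two facts drive the induction.

    A pinning element e lies in a pentagram ([pentagram_through]).  Cutting both
    circles at e turns A minus e into a permutation.  If the permutation avoids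
    2413 and 3142 then it is separable: it splits into a direct or a skew sum
    ([pattern_or_decomposable]), and descending into a summand one reaches two
    elements which are adjacent in position and in value
    ([pattern_or_close_pair]), hence twins of A other than e.  So one of the two
    patterns occurs, and together with e it forms a pentagram.

    If A has at least six elements and a pinning element, then some element f
    of A lies in a pentagram and can be deleted so that the rest still has a
    pinning element ([pentagram_deletion]).  New twins created by deleting f
    are either the two p-neighbours or the two q-neighbours of f.  If the
    pinning element e has a twin z, delete e: all new twins contain z.  If there
    are no twins, every f lies in a pentagram, and deleting f fails only if its
    two p-neighbours are q-neighbours of each other and conversely.  This cannot
    happen for three consecutive elements unless A has just five elements
    ([deletable]).

    Every deletion loses a pentagram, and the last five elements contribute one
    more, so that there are at least #|M| - 4 pentagrams ([many_pentagrams]),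
    and #|M| is half the number of vertices. *)

(** * Linear orders: the patterns 2413 and 3142 *)

(* Facts about membership in a set only slow the arithmetic down. *)
Ltac natlia :=
  repeat match goal with H : context [@in_mem] |- _ => clear H end; lia.

Section Orders.
Variable E : finType.
Implicit Types (A B C F : {set E}) (p q : E -> nat) (x y z e : E).

Definition has_2413_or_3142 A p q : Prop :=
  exists w x y z, [/\ [/\ w \in A, x \in A, y \in A & z \in A],
    p w < p x < p y /\ p y < p z &
    (q x < q z < q w /\ q w < q y) \/ (q y < q w < q z /\ q z < q x)].

Definition precedes p C B : Prop := {in C & B, forall c b, p c < p b}.

(** A direct sum (first disjunct) or a skew sum of two smaller permutations. *)
Definition decomposable A p q : Prop :=
  exists C, [/\ C \proper A, C != set0, precedes p C (A :\: C) &
    precedes q C (A :\: C) \/ precedes q (A :\: C) C].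

(** Reversing the second order exchanges the two patterns and the two kinds of
    sums, which halves the case analysis below. *)
Definition flip q x : nat := (\max_y q y) - q x.

Lemma flip_lt q x y : (flip q x < flip q y) = (q y < q x).
Proof.
have hx : q x <= \max_z q z by apply: leq_bigmax.
have hy : q y <= \max_z q z by apply: leq_bigmax.
by rewrite /flip; lia.
Qed.

Lemma pattern_flip A p q : 
  has_2413_or_3142 A p (flip q) -> has_2413_or_3142 A p q.
Proof.
move=> [w [x [y [z [hA hp hq]]]]]; exists w, x, y, z; split=> //.
by move: hq; rewrite !flip_lt; lia.
Qed.

Lemma decomposable_flip A p q : decomposable A p (flip q) -> decomposable A p q.
Proof.
move=> [C [h1 h2 h3 h4]]; exists C; split=> //.
by case: h4 => h; [right | left] => c b hc hb; move: (h b c hb hc);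
  rewrite flip_lt.
Qed.

(** How a direct sum C, D absorbs a new first element x.  If q places x below
    all of D, then x joins C.  If q places x above everything, {x} is a skew
    summand.  Otherwise q cuts D at x into a lower and an upper part: either
    an upper element u' comes before a lower element v', and x, C, u', v' is an
    occurrence of 2413, or the set of elements up to x for q is an initial
    segment for p as well. *)
Lemma add_first_to_sum A p q x C :
    {in A &, injective p} -> {in A &, injective q} ->
    x \in A -> {in A, forall y, p x <= p y} ->
    C \proper A :\ x -> C != set0 ->
    precedes p C ((A :\ x) :\: C) -> precedes q C ((A :\ x) :\: C) ->
  has_2413_or_3142 A p q \/ decomposable A p q.
Proof.
move=> pI qI xA xmin Cprop C0 pC qC.
have [c cC] := set0Pn _ C0.
have /andP[/subsetP CA _] := Cprop.
have [_ [d0 d0A d0C]] := properP Cprop.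
have xmin' y : y \in A -> y != x -> p x < p y.
  move=> yA yx; rewrite ltn_neqAle xmin // andbT; apply: contra yx => /eqP h.
  by apply/eqP/pI.
have qne y : y \in A -> y != x -> q y != q x.
  by move=> yA; apply: contra => /eqP h; apply/eqP/qI.
have [allD|] := boolP [forall d in (A :\ x) :\: C, q x < q d].
  right; exists (x |: C).
  have dec b : b \in A :\: (x |: C) -> b \in (A :\ x) :\: C.
    by rewrite !inE; case: (b == x); case: (b \in C).
  split.
  - apply/properP; split.
      by apply/subsetP=> y; rewrite !inE => /orP[/eqP->//|/CA];
        rewrite !inE => /andP[].
    exists d0; first by move: d0A; rewrite !inE => /andP[].
    by move: d0A; rewrite !inE (negPf d0C) orbF => /andP[].
  - by apply/set0Pn; exists x; rewrite !inE eqxx.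
  - move=> y b; rewrite inE => /orP[yx|yC] /dec bD; last exact: pC.
    move: yx; rewrite inE => /eqP ->; move: bD; rewrite !inE => /and3P[_ bx bA].
    exact: xmin'.
  - left=> y b; rewrite inE => /orP[yx|yC] /dec bD; last exact: qC.
    by move: yx; rewrite inE => /eqP ->; apply: (forall_inP allD).
rewrite negb_forall_in => /exists_inP[v vD]; rewrite -leqNgt => qv.
have Clow y : y \in C -> q y < q x.
  by move=> yC; apply: leq_trans qv; apply: qC.
have [allA|] := boolP [forall u in A, q u <= q x].
  right; exists [set x]; split.
  - apply/properP; split; first by rewrite sub1set.
    by exists c; rewrite ?inE; move: (CA c cC); rewrite !inE => /andP[].
  - by apply/set0Pn; exists x; rewrite inE.
  - by move=> y b; rewrite !inE => /eqP-> /andP[bx bA]; apply: xmin'.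
  - right=> b y; rewrite !inE => /andP[bx bA] /eqP ->.
    by rewrite ltn_neqAle qne //; apply: (forall_inP allA).
rewrite negb_forall_in => /exists_inP[u uA]; rewrite -ltnNge => qu.
have [/existsP[u' /existsP[v' /and4P[uD vD' /andP[qv' qu'] puv]]]|npat] := boolP
  [exists u', exists v', [&& u' \in (A :\ x) :\: C, v' \in (A :\ x) :\: C,
     q v' < q x < q u' & p u' < p v']].
  left; exists x, c, u', v'.
  have cA : c \in A by move: (CA c cC); rewrite !inE => /andP[].
  have cx : c != x by move: (CA c cC); rewrite !inE => /andP[].
  have [u'A v'A] : u' \in A /\ v' \in A.
    by move: uD vD'; rewrite !inE => /and3P[_ _ ->] /and3P[_ _ ->].
  split=> //; first by rewrite xmin' // pC.
  by left; rewrite qv' andbT; split; first exact: qC.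
right; exists [set z in A | q z <= q x]; split.
- apply/properP; split; first by apply/subsetP=> y; rewrite inE => /andP[].
  by exists u => //; rewrite inE uA -ltnNge.
- by apply/set0Pn; exists x; rewrite inE xA /=.
- move=> y b; rewrite !inE => /andP[yA qy] /andP[+ bA];
    rewrite bA /= -ltnNge => qb.
  have bx : b != x by apply: contraL qb => /eqP->; rewrite ltnn.
  have [->|yx] := eqVneq y x; first exact: xmin'.
  have bD : b \in (A :\ x) :\: C.
    by rewrite !inE bx bA !andbT; apply: contraTN qb => /Clow;
      rewrite -leqNgt; apply: ltnW.
  have [yC|yC] := boolP (y \in C); first exact: pC.
  have qyx := qne y yA yx.
  have yb : p y != p b by apply: contraTN qb => /eqP/pI <- //; rewrite -leqNgt.
  rewrite ltn_neqAle yb leqNgt /=; apply: contra npat => pby.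
  apply/existsP; exists b; apply/existsP; exists y.
  by rewrite bD pby !inE yA yx yC qb ltn_neqAle qyx qy.
- left=> y b; rewrite !inE => /andP[yA qy] /andP[+ bA]; rewrite bA /= -ltnNge.
  exact: leq_ltn_trans.
Qed.

(** Induction on the size, removing the p-first element. *)
Lemma pattern_or_decomposable A p q :
    {in A &, injective p} -> {in A &, injective q} -> 1 < #|A| ->
  has_2413_or_3142 A p q \/ decomposable A p q.
Proof.
have [n] := ubnP #|A|; elim: n A => // n IHn A leAn pI qI A1.
have [x0 x0A] : exists x, x \in A by apply/card_gt0P; lia.
pose x := [arg min_(x < x0 in A) p x].
have [xA xmin] : x \in A /\ {in A, forall y, p x <= p y}.
  by rewrite /x; case: arg_minnP => // i iA hi; split.
have subA : {subset A :\ x <= A} by move=> y; rewrite !inE => /andP[].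
have cA : #|A| = #|A :\ x|.+1 by rewrite (cardsD1 x) xA.
have [A2|A2] := ltnP 1 #|A :\ x|; last first.
  right; exists [set x].
  have /cards1P[y Ay] : #|A :\ x| == 1 by lia.
  have yA : y \in A :\ x by rewrite Ay inE.
  have [yx yA'] : y != x /\ y \in A by move: yA; rewrite !inE => /andP[].
  split.
  - by apply/properP; split; [rewrite sub1set | exists y; rewrite ?inE].
  - by apply/set0Pn; exists x; rewrite inE.
  - move=> c b; rewrite inE Ay inE => /eqP -> /eqP ->.
    rewrite ltn_neqAle xmin // andbT; apply: contra yx => /eqP h.
    by apply/eqP/pI.
  - have : q x != q y by apply: contra yx => /eqP h; apply/eqP/qI.
    rewrite neq_ltn => /orP[] h; [left | right] => c b; rewrite Ay !inE.
      by move=> /eqP -> /eqP ->.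
    by move=> /eqP -> /eqP ->.
have [] := IHn (A :\ x) _ _ _ A2; first by lia.
- by move=> y z /subA + /subA; apply: pI.
- by move=> y z /subA + /subA; apply: qI.
- move=> [w [x1 [y [z [[/subA h1 /subA h2 /subA h3 /subA h4] hp hq]]]]].
  by left; exists w, x1, y, z.
move=> [C [h1 h2 h3 [h4|h4]]];
  first exact: (add_first_to_sum (x := x) (C := C)).
have [] := @add_first_to_sum A p (flip q) x C => //.
- move=> y z yA zA h; apply: qI => //.
  by have := flip_lt q y z; have := flip_lt q z y; rewrite h ltnn; clear; lia.
- by move=> c b hc hb; rewrite flip_lt; apply: h4.
- by move/pattern_flip; left.
- by move/decomposable_flip; right.
Qed.

Definition between p x y z := (p x < p z < p y) || (p y < p z < p x).

(** Both summands are intervals for p and for q, so a close pair of a summand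
    with at least two elements is a close pair of A. *)
Lemma pattern_or_close_pair A p q :
    {in A &, injective p} -> {in A &, injective q} -> 1 < #|A| ->
  has_2413_or_3142 A p q \/
  exists x y, [/\ x \in A, y \in A, x != y &
    {in A, forall z, ~~ between p x y z && ~~ between q x y z}].
Proof.
have [n] := ubnP #|A|; elim: n A => // n IHn A leAn pI qI A1.
have [h|[C [Cprop C0 pC qC]]] := pattern_or_decomposable pI qI A1;
  first by left.
have subp B : B \proper A ->
    {in A :\: B, forall z,
      {in B &, forall x y, ~~ between p x y z && ~~ between q x y z}} ->
    1 < #|B| ->
  has_2413_or_3142 A p q \/
  exists x y, [/\ x \in A, y \in A, x != y &
    {in A, forall z, ~~ between p x y z && ~~ between q x y z}].
  move=> BA Bconv B1.
  have /andP[/subsetP sBA _] := BA.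
  have [] := IHn B _ _ _ B1; first by have := proper_card BA; lia.
  - by move=> y z /sBA + /sBA; apply: pI.
  - by move=> y z /sBA + /sBA; apply: qI.
  - move=> [w [x [y [z [[/sBA h1 /sBA h2 /sBA h3 /sBA h4] hp hq]]]]].
    by left; exists w, x, y, z.
  move=> [x [y [xB yB xy hxy]]]; right; exists x, y; split=> //; try exact: sBA.
  move=> z zA; have [zB|zB] := boolP (z \in B); first exact: hxy.
  by apply: Bconv => //; rewrite inE zB.
have /andP[CA _] := Cprop.
have cA : #|A| = #|C| + #|A :\: C| by rewrite -(cardsID C A) (setIidPr CA).
have [C1|C1] := ltnP 1 #|C|.
  apply: subp C1 => // z zD x y xC yC; rewrite /between.
  have := pC x z xC zD; have := pC y z yC zD.
  by case: qC => qC; [have := qC x z xC zD; have := qC y z yC zD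
    | have := qC z x zD xC; have := qC z y zD yC]; natlia.
have [D1|D1] := ltnP 1 #|A :\: C|.
  have [c cC] := set0Pn _ C0.
  apply: (subp (A :\: C)) D1.
    apply/properP; split; first exact: subsetDl.
    by exists c; [exact: (subsetP CA) | rewrite inE cC].
  move=> z; rewrite setDDr setDv set0U inE => /andP[_ zC] x y xD yD;
    rewrite /between.
  have := pC z x zC xD; have := pC z y zC yD.
  by case: qC => qC; [have := qC z x zC xD; have := qC z y zC yD
    | have := qC x z xD zC; have := qC y z yD zC]; natlia.
have /cards1P[x Cx] : #|C| == 1.
  by rewrite eqn_leq C1 card_gt0.
have /cards1P[y Dy] : #|A :\: C| == 1 by lia.
have AE : A =i [set x; y].
  by move=> z; rewrite -(setID A C) (setIidPr CA) Dy Cx.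
right; exists x, y; split; rewrite ?AE ?inE ?eqxx ?orbT //.
  by apply/eqP=> xy; move: Dy; rewrite -xy -Cx => /setP/(_ x);
    rewrite !inE Cx inE eqxx.
by move=> z; rewrite AE !inE /between => /orP[]/eqP->; lia.
Qed.

End Orders.

(** * Cyclic orders: neighbours, twins and pentagrams *)

Section Cyc.
Variable E : finType.
Implicit Types (A B C F : {set E}) (p q : E -> nat) (x y z e : E).

(** y lies on the open arc of the circle that runs from x upwards to z. *)
Definition cyc p x y z :=
  [|| p x < p y < p z, p y < p z < p x | p z < p x < p y].

Definition neighbours A p x y :=
  (x != y) && ([forall z in A, ~~ cyc p x z y] ||
                [forall z in A, ~~ cyc p y z x]).

Definition twins A p q x y := neighbours A p x y && neighbours A q x y.

Definition pinned A p q e :=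
  [forall x in A, forall y in A, twins A p q x y ==> (e == x) || (e == y)].

Lemma pinnedP A p q e :
  reflect {in A &, forall x y, twins A p q x y -> e = x \/ e = y}
          (pinned A p q e).
Proof.
apply: (iffP forall_inP) => [h x y xA yA t | h x xA].
  by have := forall_inP (h x xA) y yA; rewrite t => /orP[]/eqP; [left | right].
apply/forall_inP=> y yA; apply/implyP => t.
by have [->|->] := h x y xA yA t; rewrite eqxx ?orbT.
Qed.

Lemma unpinned A p q e : ~~ pinned A p q e ->
  exists x y, [/\ x \in A, y \in A, twins A p q x y, e != x & e != y].
Proof.
rewrite negb_forall_in => /exists_inP[x xA].
rewrite negb_forall_in => /exists_inP[y yA].
rewrite negb_imply negb_or => /and3P[t ex ey].
by exists x, y.
Qed.

Definition cyc_sorted p (s : seq E) :=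
  exists k, sorted (relpre p ltn) (rot k s).

(** The cyclic permutations 13524 and 14253, which are the two orientations of
    the pentagram: with the edges of a 5-cycle drawn for each of the orders, and
    the two copies of each element joined, they give the Petersen graph. *)
Definition pentagram F p q := exists x1 x2 x3 x4 x5,
  [/\ F = [set x in [:: x1; x2; x3; x4; x5]],
      cyc_sorted p [:: x1; x2; x3; x4; x5] &
      cyc_sorted q [:: x1; x3; x5; x2; x4] \/
      cyc_sorted q [:: x1; x4; x2; x5; x3]].

(** The linear order obtained by cutting the circle just before e. *)
Definition cut p e x :=
  if p e <= p x then p x - p e else p x + (\max_y p y).+1 - p e.

Lemma leq_max p x : p x <= \max_y p y. Proof. exact: leq_bigmax. Qed.

Lemma cut_eq p e x y : cut p e x = cut p e y -> p x = p y.
Proof.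
have := leq_max p x; have := leq_max p y; have := leq_max p e.
by rewrite /cut; do 2!case: ifP; lia.
Qed.

Lemma cut0 p e x : p x != p e -> cut p e e < cut p e x.
Proof.
have := leq_max p x; have := leq_max p e.
by rewrite /cut; do 2!case: ifP; lia.
Qed.

Lemma cyc_cut p e x y z : cyc (cut p e) x y z = cyc p x y z.
Proof.
have := leq_max p x; have := leq_max p y; have := leq_max p z.
by have := leq_max p e; rewrite /cyc /cut; do 3!case: ifP; lia.
Qed.

(** In a list sorted from the cut onwards, the elements after the wrap-around
    come last; k is the place where they begin. *)
Lemma sorted_cut p e s : sorted (relpre (cut p e) ltn) s -> cyc_sorted p s.
Proof.
have trp f : transitive (relpre f ltn : rel E) by move=> x y z /=;
  apply: ltn_trans.
pose k := find (fun z => p z < p e) s; exists k; move: H.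
rewrite !sorted_pairwise // -{1}(cat_take_drop k s) pairwise_cat =>
  /and3P[_ hT hD].
have inT x : x \in take k s -> p e <= p x.
  move=> xT; rewrite leqNgt; apply/negP => px.
  have : has (fun z => p z < p e) (take k s) by apply/hasP; exists x.
  by rewrite has_take_leq ?find_size // ltnn.
have inD x : x \in drop k s -> p x < p e.
  move: hD; case dk: (drop k s) => [//|y d] /= /andP[/allP yd _].
  have py : p y < p e.
    have ks : k < size s.
      by rewrite ltnNge; apply/negP => /drop_oversize; rewrite dk.
    have : p (nth y s k) < p e by apply: (@nth_find _ y (fun z => p z < p e));
      rewrite has_find.
    by rewrite -[k]addn0 -nth_drop dk.
  rewrite inE => /orP[/eqP->//|/yd /=].
  by have := leq_max p x; rewrite /cut; do 2!case: ifP; lia.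
rewrite /rot pairwise_cat; apply/and3P; split.
- by apply/allrelP => x y /inD px /inT py; apply: leq_trans py.
- apply: (sub_in_pairwise (P := fun z => p z < p e)) hD; last exact/allP.
  by move=> x y; rewrite !unfold_in /= /cut => hx hy; do 2!case: ifP; lia.
- apply: (sub_in_pairwise (P := fun z => p e <= p z)) hT; last exact/allP.
  by move=> x y; rewrite !unfold_in /= /cut => hx hy; do 2!case: ifP; lia.
Qed.

Lemma neighbours_sym A p x y : neighbours A p x y = neighbours A p y x.
Proof. by rewrite /neighbours eq_sym orbC. Qed.

(** With e in front, an occurrence of 2413 or 3142 in the cut orders is the
    cyclic pattern 13524 or 14253.  Adjacent elements of the cut orders are
    neighbours on the circles, because e is extreme in both. *)
Lemma pentagram_through A p q e :
    {in A &, injective p} -> {in A &, injective q} -> 2 < #|A| -> e \in A ->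
    pinned A p q e ->
  exists F, [/\ e \in F, F \subset A & pentagram F p q].
Proof.
move=> pI qI A2 eA /pinnedP twe.
have subA : {subset A :\ e <= A} by move=> y; rewrite !inE => /andP[].
have ne f x : {in A &, injective f} -> x \in A :\ e -> cut f e e < cut f e x.
  move=> fI; rewrite !inE => /andP[xe xA]; apply: cut0.
  by apply: contra xe => /eqP h; apply/eqP/fI.
have cI f : {in A &, injective f} -> {in A :\ e &, injective (cut f e)}.
  by move=> fI x y /subA xA /subA yA /cut_eq; apply: fI.
have [] := pattern_or_close_pair (cI _ pI) (cI _ qI).
- by have := cardsD1 e A; rewrite eA; lia.
- move=> [w [x [y [z [[wA xA yA zA] hp hq]]]]].
  exists [set u in [:: e; w; x; y; z]]; split.
  + by rewrite !inE eqxx.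
  + apply/subsetP => u; rewrite !inE.
    by case/or4P => [||/eqP->|/orP[]]; try move/eqP->; auto.
  exists e, w, x, y, z; split=> //.
    apply: (@sorted_cut _ e); rewrite /= (ne p w) //.
    by case: hp => /andP[-> ->] ->.
  case: hq => -[/andP[h1 h2] h3]; [left | right]; apply: (@sorted_cut _ e).
    by rewrite /= (ne q x) // h1 h2 h3.
  by rewrite /= (ne q y) // h1 h2 h3.
move=> [x [y [xA yA xy hxy]]].
suff [/eqP | /eqP] : e = x \/ e = y.
- by move: xA; rewrite !inE eq_sym => /andP[/negPf->].
- by move: yA; rewrite !inE eq_sym => /andP[/negPf->].
have nb f : {in A &, injective f} ->
    {in A :\ e, forall z, ~~ between (cut f e) x y z} -> neighbours A f x y.
  move=> fI hf; rewrite /neighbours xy /=.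
  have hf' z : z \in A -> ~~ between (cut f e) x y z.
    move=> zA; have [->|ze] := eqVneq z e; last by apply: hf; rewrite !inE ze.
    by have := ne f x fI xA; have := ne f y fI yA; rewrite /between; lia.
  have [xyf|xyf] := ltnP (cut f e x) (cut f e y).
    apply/orP; left; apply/forall_inP => z /hf';
      rewrite -(cyc_cut f e) /cyc /between; natlia.
  apply/orP; right; apply/forall_inP => z /hf';
    rewrite -(cyc_cut f e) /cyc /between; natlia.
apply: twe; try exact: subA.
by apply/andP; split; apply: nb => // z /hxy/andP[].
Qed.

(** Two of three neighbours of x would lie on the same side of x, and then one
    of them separates x from the other. *)
Lemma neighbours_le2 A p x a b c :
    {in A &, injective p} -> x \in A -> a \in A -> b \in A -> c \in A ->
    neighbours A p x a -> neighbours A p x b -> neighbours A p x c ->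
  a != b -> c = a \/ c = b.
Proof.
move=> pI xA aA bA cA.
have ne u v : u \in A -> v \in A -> u != v -> p u != p v.
  by move=> uA vA; apply: contra => /eqP h; apply/eqP/pI.
move=> /andP[xa ha] /andP[xb hb] /andP[xc hc] ab.
have [->|ca] := eqVneq c a; first by left.
have [->|cb] := eqVneq c b; first by right.
have := ne _ _ xA aA xa; have := ne _ _ xA bA xb; have := ne _ _ xA cA xc.
have := ne _ _ aA bA ab; have := ne _ _ cA bA cb; have := ne _ _ cA aA ca.
case/orP: ha => /forall_inP ha; have := ha b bA; have := ha c cA; clear ha;
case/orP: hb => /forall_inP hb; have := hb a aA; have := hb c cA; clear hb;
case/orP: hc => /forall_inP hc; have := hc b bA; have := hc a aA; clear;
rewrite /cyc; lia.
Qed.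

(** If the arc from x to y is empty but for e, then so are its two halves. *)
Lemma new_neighbours A p e x y :
    x \in A :\ e -> y \in A :\ e ->
    neighbours (A :\ e) p x y -> neighbours A p x y \/
  neighbours A p e x /\ neighbours A p e y.
Proof.
wlog H : x y / [forall z in A :\ e, ~~ cyc p x z y].
  move=> hw xA yA n; have /andP[xy /orP[h|h]] := n; first exact: hw.
  by have := hw y x h yA xA;
    rewrite ![neighbours _ _ y x]neighbours_sym => /(_ n); tauto.
rewrite !inE => /andP[xe xA] /andP[ye yA] /andP[xy _].
have [exy|exy] := boolP (cyc p x e y); [right | left]; last first.
  rewrite /neighbours xy; apply/orP; left; apply/forall_inP => z zA.
  have [->//|ze] := eqVneq z e.
  by apply: (forall_inP H); rewrite !inE ze.
have Hz z : z \in A -> z != e -> ~~ cyc p x z y.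
  by move=> zA ze; apply: (forall_inP H); rewrite !inE ze.
split.
  rewrite /neighbours eq_sym xe; apply/orP; right; apply/forall_inP => z zA.
  have [->|ze] := eqVneq z e; first by clear; rewrite /cyc; lia.
  by have := Hz z zA ze; move: exy; clear; rewrite /cyc; lia.
rewrite /neighbours eq_sym ye; apply/orP; left; apply/forall_inP => z zA.
have [->|ze] := eqVneq z e; first by clear; rewrite /cyc; lia.
by have := Hz z zA ze; move: exy; clear; rewrite /cyc; lia.
Qed.

(** The five p-smallest elements; the middle one and the sixth show that both
    arcs between the first and the fifth are occupied. *)
Lemma five_consecutive A p : {in A &, injective p} -> 5 < #|A| ->
  exists x0 x1 x2 x3 x4,
  [/\ {subset [:: x0; x1; x2; x3; x4] <= A}, uniq [:: x0; x1; x2; x3; x4],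
      neighbours A p x0 x1 /\ neighbours A p x1 x2,
      neighbours A p x2 x3 /\ neighbours A p x3 x4 & ~~ neighbours A p x0 x4].
Proof.
move=> pI; rewrite cardE.
have [s sE] : exists s, s = sort (relpre p leq) (enum A) by eexists.
have memA z : (z \in A) = (z \in s) by rewrite sE mem_sort mem_enum.
have : sorted ltn (map p s).
  rewrite ltn_sorted_uniq_leq sorted_map; apply/andP; split.
    rewrite map_inj_in_uniq; first by rewrite sE sort_uniq enum_uniq.
    by move=> x y; rewrite -!memA; apply: pI.
  by rewrite sE; apply: sort_sorted => x y; apply: leq_total.
have <- : size s = size (enum A) by rewrite sE size_sort.
move: memA; clear; case: s => [|x0 [|x1 [|x2 [|x3 [|x4 [|x5 r]]]]]] memA //.
set r' := x5 :: r in memA *.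
rewrite /= =>
  /and5P[h1 h2 h3 h4 /andP[h5 /(order_path_min ltn_trans) /allP h6]] _.
have hz z : z \in A -> [\/ z \in [:: x0; x1; x2; x3; x4], z = x5 | p x5 < p z].
  rewrite memA -[_ :: _]/([:: x0; x1; x2; x3; x4] ++ (x5 :: r)) mem_cat inE.
  case/or3P=> [|/eqP|zr].
  - by constructor 1.
  - by constructor 2.
  by constructor 3; apply: (h6 (p z)); apply: map_f.
have nb x y : p x < p y ->
    (forall z, z \in [:: x0; x1; x2; x3; x4] -> ~~ cyc p x z y) ->
    p y < p x5 -> neighbours A p x y.
  move=> xy h y5; apply/andP; split; first by apply: contraTN xy => /eqP ->;
    rewrite ltnn.
  apply/orP; left; apply/forall_inP => z /hz [|->|]; first exact: h.
    by move: xy y5; clear; rewrite /cyc; lia.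
  by move: xy y5; clear; rewrite /cyc; lia.
exists x0, x1, x2, x3, x4; split.
- move=> z zs.
  by rewrite memA -[_ :: _]/([:: x0; x1; x2; x3; x4] ++ r') mem_cat zs.
- suff h : uniq (map p [:: x0; x1; x2; x3; x4]) by exact: map_uniq h.
  apply: (sorted_uniq ltn_trans ltnn).
  by rewrite /= h1 h2 h3 h4.
- by split; apply: nb; try natlia; move=> z; rewrite !inE;
  repeat (case/orP; [by move/eqP->; rewrite /cyc; natlia|]);
  move/eqP->; rewrite /cyc; natlia.
- by split; apply: nb; try natlia; move=> z; rewrite !inE;
  repeat (case/orP; [by move/eqP->; rewrite /cyc; natlia|]);
  move/eqP->; rewrite /cyc; natlia.
- rewrite /neighbours negb_and negb_or; apply/orP; right; apply/andP; split.
    apply/forall_inPn; exists x2; last by rewrite /cyc; natlia.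
    by rewrite memA !inE eqxx !orbT.
  apply/forall_inPn; exists x5; last by rewrite /cyc; natlia.
  by rewrite memA !inE eqxx !orbT.
Qed.

(** A new pair of twins consists of both p-neighbours or both q-neighbours of
    e, and z is among these. *)
Lemma pinned_delete_twin A p q e z :
    {in A &, injective p} -> {in A &, injective q} -> e \in A -> z \in A ->
  pinned A p q e -> twins A p q e z -> pinned (A :\ e) p q z.
Proof.
move=> pI qI eA zA /pinnedP pin /andP[ezp ezq];
  apply/pinnedP=> x y xD yD /andP[xyp xyq].
have [xA yA] : x \in A /\ y \in A.
  by move: xD yD; rewrite !inE => /andP[_ ->] /andP[_ ->].
have xy : x != y by case/andP: xyp.
have [np|[npx npy]] := new_neighbours xD yD xyp; last first.
  exact: (neighbours_le2 pI eA xA yA zA).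
have [nq|[nqx nqy]] := new_neighbours xD yD xyq; last first.
  exact: (neighbours_le2 qI eA xA yA zA).
have [ex|ey] : e = x \/ e = y by apply: pin => //; apply/andP.
  by move: xD; rewrite ex !inE eqxx.
by move: yD; rewrite ey !inE eqxx.
Qed.

(** What prevents the deletion of f.  Since a does not pin the rest, there is
    a new pair of twins that avoids a, hence is not the pair of p-neighbours of
    f: it is the pair c, d of q-neighbours.  Since c does not pin the rest, some
    new pair of twins is not c, d: it is the pair a, b.  That these pairs were
    neighbours already before the deletion follows from their being distinct. *)
Lemma undeletable_neighbours A p q f a b :
    {in A &, injective p} -> {in A &, injective q} -> f \in A ->
    {in A &, forall x y, ~~ twins A p q x y} ->
    {in A :\ f, forall e, ~~ pinned (A :\ f) p q e} ->
    a \in A -> b \in A -> a != b -> neighbours A p f a -> neighbours A p f b ->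
  neighbours A q a b /\
  exists c d, [/\ c \in A, d \in A, neighbours A q f c,
       neighbours A q f d & neighbours A p c d].
Proof.
move=> pI qI fA notw nopin aA bA ab fa fb.
have inA x : x \in A :\ f -> x \in A by rewrite !inE => /andP[].
have aD : a \in A :\ f by rewrite !inE aA andbT eq_sym; case/andP: fa.
have [c [d [cD dD /andP[cdp cdq] ac ad]]] := unpinned (nopin a aD).
have cd : c != d by case/andP: cdp.
have cdP : neighbours A p c d.
  have [//|[fc fd]] := new_neighbours cD dD cdp.
  have [] := neighbours_le2 pI fA (inA _ cD) (inA _ dD) aA fc fd fa cd.
    by move=> h; rewrite h eqxx in ac.
  by move=> h; rewrite h eqxx in ad.
have [fc fd] : neighbours A q f c /\ neighbours A q f d.
  have [cdQ|//] := new_neighbours cD dD cdq.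
  by have := notw c d (inA _ cD) (inA _ dD); rewrite /twins cdP cdQ.
split; last by exists c, d; split=> //; apply: inA.
have [x [y [xD yD /andP[xyp xyq] cx cy]]] := unpinned (nopin c cD).
have xy : x != y by case/andP: xyp.
have xyQ : neighbours A q x y.
  have [//|[fx fy]] := new_neighbours xD yD xyq.
  have [] := neighbours_le2 qI fA (inA _ xD) (inA _ yD) (inA _ cD) fx fy fc xy.
    by move=> h; rewrite h eqxx in cx.
  by move=> h; rewrite h eqxx in cy.
have [fx fy] : neighbours A p f x /\ neighbours A p f y.
  have [xyP|//] := new_neighbours xD yD xyp.
  by have := notw x y (inA _ xD) (inA _ yD); rewrite /twins xyP xyQ.
have [] := neighbours_le2 pI fA (inA _ xD) (inA _ yD) aA fx fy fa xy;
have [] := neighbours_le2 pI fA (inA _ xD) (inA _ yD) bA fx fy fb xy;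
  move=> hb ha; rewrite ?ha ?hb // in ab *; rewrite ?eqxx // in ab *.
by rewrite neighbours_sym.
Qed.

(** Let x0, .., x4 be consecutive for p, with none of x1, x2, x3 deletable.
    From x1 and x3, the q-neighbours of x2 are x0 and x4; then from x2, these
    are neighbours for p, which closes the p-circle after five elements. *)
Lemma deletable A p q :
    {in A &, injective p} -> {in A &, injective q} -> 5 < #|A| ->
    {in A &, forall x y, ~~ twins A p q x y} ->
  exists2 f, f \in A & exists2 e, e \in A :\ f & pinned (A :\ f) p q e.
Proof.
move=> pI qI A5 notw.
have [/exists_inP[f fA /exists_inP[e eD pin]]|no] := boolP
  [exists f in A, exists e in A :\ f, pinned (A :\ f) p q e].
  by exists f => //; exists e.
have nopin f : f \in A -> {in A :\ f, forall e, ~~ pinned (A :\ f) p q e}.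
  move=> fA e eD; apply: contra no => pin.
  by apply/exists_inP; exists f => //; apply/exists_inP; exists e.
have [x0 [x1 [x2 [x3 [x4 [sA u [n01 n12] [n23 n34] n04]]]]]] :=
  five_consecutive pI A5.
have [A0 A1 A2 A3 A4] : [/\ x0 \in A, x1 \in A, x2 \in A, x3 \in A & x4 \in A].
  by split; apply: sA; rewrite !inE eqxx ?orbT.
have [d02 d13 d24 d04] : [/\ x0 != x2, x1 != x3, x2 != x4 & x0 != x4].
  move: u; rewrite /= !inE !negb_or -!andbA.
  by case/and5P=> _ -> _ -> /and5P[_ -> _ _ /andP[-> _]].
have und f a b fA :=
  @undeletable_neighbours A p q f a b pI qI fA notw (nopin f fA).
have n10 : neighbours A p x1 x0 by rewrite neighbours_sym.
have n21 : neighbours A p x2 x1 by rewrite neighbours_sym.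
have n32 : neighbours A p x3 x2 by rewrite neighbours_sym.
have [q02 _] := und x1 x0 x2 A1 A0 A2 d02 n10 n12.
have [q24 _] := und x3 x2 x4 A3 A2 A4 d24 n32 n34.
have [_ [c [d [cA dA q2c q2d cd]]]] := und x2 x1 x3 A2 A1 A3 d13 n21 n23.
have cd' : c != d by case/andP: cd.
rewrite neighbours_sym in q02.
case/negP: n04.
have [] := neighbours_le2 qI A2 A0 A4 cA q02 q24 q2c d04;
have [] := neighbours_le2 qI A2 A0 A4 dA q02 q24 q2d d04;
  move=> hd hc; rewrite hc hd ?eqxx // in cd cd' *.
by rewrite neighbours_sym.
Qed.

Lemma pentagram_deletion A p q e :
    {in A &, injective p} -> {in A &, injective q} -> 5 < #|A| ->
    e \in A -> pinned A p q e ->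
  exists f F, [/\ f \in F, F \subset A, pentagram F p q &
    exists2 e', e' \in A :\ f & pinned (A :\ f) p q e'].
Proof.
move=> pI qI A5 eA pin.
have A2 : 2 < #|A| by lia.
have [/exists_inP[z zA tw]|notw] := boolP [exists z in A, twins A p q e z].
  have [F [eF FA sF]] := pentagram_through pI qI A2 eA pin.
  exists e, F; split=> //; exists z; last exact: pinned_delete_twin.
  by rewrite !inE zA andbT eq_sym; case/andP: tw => /andP[].
have notw' : {in A &, forall x y, ~~ twins A p q x y}.
  move=> x y xA yA; apply: contra notw => t; apply/exists_inP.
  have [->|->] := pinnedP _ _ _ _ pin x y xA yA t; first by exists y.
  by exists x => //; rewrite /twins ![neighbours _ _ y x]neighbours_sym.
have [f fA he] := deletable pI qI A5 notw'.
have [|F [fF FA sF]] := pentagram_through pI qI A2 fA.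
  by apply/pinnedP=> x y xA yA t; have := notw' x y xA yA; rewrite t.
by exists f, F.
Qed.

(** The pentagram through the deleted element is not among those of the rest;
    this gives one pentagram for each size from #|A| down to 5. *)
Lemma many_pentagrams A p q e :
    {in A &, injective p} -> {in A &, injective q} -> e \in A ->
    pinned A p q e ->
  exists S : {set {set E}},
    {in S, forall F, F \subset A /\ pentagram F p q} /\ #|A| - 4 <= #|S|.
Proof.
have [n] := ubnP #|A|; elim: n A e => // n IHn A e leAn pI qI eA pin.
have [A4|A4] := leqP #|A| 4.
  exists set0; split; first by move=> F; rewrite inE.
  by rewrite cards0; clear -A4; lia.
have [A5|A5] := leqP #|A| 5.
  have A2 : 2 < #|A| by clear -A4; lia.
  have [F [eF FA sF]] := pentagram_through pI qI A2 eA pin.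
  exists [set F]; split; last by rewrite cards1; clear -A5; lia.
  by move=> F'; rewrite inE => /eqP->.
have [f [F [fF FA sF [e' eD pin']]]] := pentagram_deletion pI qI A5 eA pin.
have subA : {subset A :\ f <= A} by move=> y; rewrite !inE => /andP[].
have cA : #|A| = #|A :\ f|.+1 by rewrite (cardsD1 f A) (subsetP FA).
have [] := IHn (A :\ f) e' _ _ _ eD pin'.
- by clear -cA leAn; lia.
- by move=> y z /subA + /subA; apply: pI.
- by move=> y z /subA + /subA; apply: qI.
move=> S [hS cS]; exists (F |: S); split.
  move=> F'; rewrite in_setU1 => /orP[/eqP->//|/hS[sub st]]; split=> //.
  by apply: subset_trans sub _; apply: subsetDl.
rewrite cardsU1 cA.
have -> : F \notin S.
  by apply/negP=> /hS[/subsetP/(_ f fF)]; rewrite !inE eqxx.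
by clear -cS A5 cA; lia.
Qed.

End Cyc.

(** * Cycles, subdivisions and the Petersen graph *)

Section Cycles.
Variable T : finType.
Implicit Types (s t r : seq T) (x y z : T) (V D : {set T}) (R M : {set {set T}})
  (G H K P : graph T).

Definition cycle_edges s : {set {set T}} := [set [set x; next s x] | x in s].

Lemma cycle_edges_rot n s : uniq s -> cycle_edges (rot n s) = cycle_edges s.
Proof.
move=> us; apply/setP=> e.
by apply/imsetP/imsetP => -[x xs ->]; exists x;
  rewrite ?next_rot ?mem_rot // in xs *.
Qed.

Lemma cycle_edges_rev s : uniq s -> cycle_edges (rev s) = cycle_edges s.
Proof.
move=> us; apply/setP => e; apply/imsetP/imsetP => -[x].
  rewrite mem_rev => xs ->; exists (prev s x); first by rewrite mem_prev.
  by rewrite next_rev // next_prev // setUC.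
move=> xs ->; exists (next s x); first by rewrite mem_rev mem_next.
by rewrite next_rev // prev_next // setUC.
Qed.

(** The edges read off along the closed walk; on this form the edges of a longer
    and of a shorter cycle can be compared by list computation. *)
Lemma cycle_edges_cons x s : uniq (x :: s) ->
  cycle_edges (x :: s) =i pairmap (fun y z => [set y; z]) x (rcons s x).
Proof.
move=> us e; set f := fun y z => [set y; z].
have nthE i : i < size (x :: s) ->
    nth set0 (pairmap f x (rcons s x)) i =
    f (nth x (x :: s) i) (next (x :: s) (nth x (x :: s) i)).
  move=> li; rewrite (nth_pairmap x) ?size_rcons //.
  have -> : nth x (x :: rcons s x) i = nth x (x :: s) i.
    by rewrite -rcons_cons nth_rcons li.
  rewrite next_nth mem_nth // index_uniq // nth_rcons.
  move: li; rewrite ltnS leq_eqVlt orbC; case: ltngtP => // -> _.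
  by rewrite (@nth_default _ x s).
apply/idP/idP => [/imsetP[y ys ->] | /(nthP set0)[i]].
  apply/(nthP set0).
  exists (index y (x :: s)); first by rewrite size_pairmap size_rcons index_mem.
  by rewrite nthE ?index_mem // nth_index.
rewrite size_pairmap size_rcons => li <-.
by apply/imsetP; exists (nth x (x :: s) i); rewrite ?mem_nth // nthE.
Qed.

Lemma pairmap_sub e x s :
  e \in pairmap (fun y z => [set y; z]) x s -> e \subset [set y in x :: s].
Proof.
elim: s x => // y s IHs x; rewrite inE => /orP[/eqP->|/IHs h].
  by apply/subsetP=> z; rewrite !inE => /orP[]->; rewrite ?orbT.
by apply: subset_trans h _; apply/subsetP=> z; rewrite !inE => ->; rewrite orbT.
Qed.

(** The length bound ensures that the closing edge of the shorter cycle is not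
    also one of its path edges. *)
Lemma cycle_edges_insert z y r : uniq (z :: y :: r) -> 1 < size r ->
  cycle_edges (z :: y :: r) =
  [set last y r; z] |:
    ([set z; y] |: cycle_edges (y :: r) :\ [set last y r; y]).
Proof.
move=> us r2; have us' : uniq (y :: r) by case/andP: us.
apply/setP=> e;
  rewrite cycle_edges_cons // in_setU1 in_setU1 in_setD1 cycle_edges_cons //.
rewrite /= -!cats1 !pairmap_cat /= in_cons !mem_cat !mem_seq1.
have [->|] := eqVneq e [set last y r; y]; last first.
  by case: (e == [set z; y]); case: (e \in _); case: (e == [set _; z]).
have nQ : [set last y r; y] \notin pairmap (fun y z => [set y; z]) y r.
  case: r r2 us' {us} => [|y1 [|y2 r]] // _;
    rewrite [uniq _]/= => /and3P[yr y1r _].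
  rewrite inE negb_or; apply/andP; split.
    apply/eqP=> /setP/(_ (last y2 r));
      rewrite !inE eqxx /= => /esym/orP[]/eqP h.
      by move: yr; rewrite -h [last _ _ \in _]inE mem_last orbT.
    by move: y1r; rewrite -h mem_last.
  apply/negP=> /(@pairmap_sub _ y1 (y2 :: r))/subsetP/(_ y);
    rewrite !inE eqxx orbT => /(_ isT) h.
  by move: yr; rewrite !inE h.
by rewrite (negPf nQ) /= orbF orbC.
Qed.

Lemma cycle_edges_card2 s e : uniq s -> 1 < size s -> e \in cycle_edges s ->
  (#|e| == 2) && (e \subset [set x in s]).
Proof.
move=> us s1 /imsetP[x xs ->]; apply/andP; split; last first.
  by apply/subsetP=> y; rewrite !inE => /orP[]/eqP->; rewrite ?mem_next.
rewrite cards2; suff -> : x != next s x by [].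
have [i r E] := rot_to xs.
have ur : uniq (x :: r) by rewrite -E rot_uniq.
have sr : 1 < size (x :: r) by rewrite -E size_rot.
rewrite -(next_rot i us) E /=; case: r ur sr {E} => // y r /=.
by rewrite eqxx !inE negb_or => /andP[/andP[->]].
Qed.

Lemma graph_eq G H : verts G = verts H -> edges G = edges H -> G = H.
Proof.
rewrite /verts /edges => hv he; apply: val_inj => /=.
by rewrite [LHS]surjective_pairing hv he -surjective_pairing.
Qed.

(** Subdividing the cycle on the vertices of s in D yields the cycle on s.  The
    rest of the graph, with vertices V and edges R, stays fixed; it meets the
    cycle only in D, so a vertex outside D has degree two and can be
    suppressed, its two neighbours not being joined by an edge of R. *)
Lemma subdivide_cycle P P0 D V R s H :
    uniq s -> [disjoint V & [set x in s]] ->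
    (forall e, e \in R -> ~~ (e \subset [set x in s])) ->
    (forall e x, e \in R -> x \in e -> x \in s -> x \in D) ->
    subdivision P0 P -> 2 < size [seq x <- s | x \in D] ->
    verts P = [set x in [seq x <- s | x \in D]] :|: V ->
    edges P = cycle_edges [seq x <- s | x \in D] :|: R ->
    verts H = [set x in s] :|: V -> edges H = cycle_edges s :|: R ->
  subdivision P0 H.
Proof.
move=> us sV R1 R2 P0P sD PV PE.
have [n] := ubnP (size s);
  elim: n s us sV R1 R2 sD PV PE H =>
  // n IHn s us sV R1 R2 sD PV PE H len HV HE.
have [/all_filterP sDE|/allPn[z zs zD]] := boolP (all (mem D) s).
  by rewrite (@graph_eq H P) // ?PV ?PE sDE.
have {}zD : z \notin D by [].
have defs := splitPr zs;
  case: defs us sV R1 R2 sD PV PE len HV HE =>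
  s1 s2 us sV R1 R2 sD PV PE len HV HE.
have DE : [seq x <- s1 ++ z :: s2 | x \in D] = [seq x <- s1 ++ s2 | x \in D].
  by rewrite !filter_cat /= (negPf zD).
rewrite DE in sD PV PE.
have us' : uniq (z :: (s2 ++ s1)) by rewrite -cat_cons uniq_catC.
have us12 : uniq (s1 ++ s2) by rewrite uniq_catC; case/andP: us'.
have mE x : (x \in s1 ++ z :: s2) = (x == z) || (x \in s1 ++ s2).
  by rewrite !mem_cat inE orbCA.
have zs' : z \in s1 ++ z :: s2 by rewrite mE eqxx.
have sub12 : [set x in s1 ++ s2] \subset [set x in s1 ++ z :: s2].
  by apply/subsetP=> x; rewrite !inE mE => ->; rewrite orbT.
have sz : 2 < size (s1 ++ s2).
  by apply: leq_trans sD _; rewrite size_filter count_size.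
have zV : z \notin V.
  by apply/negP=> zV; have := disjointFr sV zV; rewrite inE mE eqxx.
have zR e : e \in R -> z \notin e.
  by move=> eR; apply/negP=> ze; have := R2 e z eR ze zs'; rewrite (negPf zD).
have Kax : graph_axiom ([set x in s1 ++ s2] :|: V,
                         cycle_edges (s1 ++ s2) :|: R).
  apply/forall_inP=> e; rewrite in_setU => /orP[/cycle_edges_card2|eR].
    move=> /(_ us12 (ltnW sz)) /andP[-> h] /=.
    by apply: subset_trans h _; apply: subsetUl.
  have /forall_inP/(_ e) := graph_valP H;
    rewrite -/(edges H) HE in_setU eR orbT.
  move=> /(_ isT) /andP[-> /subsetP h]; apply/subsetP=> x xe.
  have := h x xe; rewrite -/(verts H) HV !in_setU !inE mE.
  by have [xz|] := eqVneq x z; [have := zR e eR; rewrite -xz xe|].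
pose K := Graph Kax.
have IH : subdivision P0 K.
  apply: (IHn (s1 ++ s2)) => //.
  - by rewrite disjoint_sym; apply: disjointWl sub12 _; rewrite disjoint_sym.
  - by move=> e eR; apply: contra (R1 e eR) => h; apply: subset_trans h sub12.
  - by move=> e x eR xe xs; apply: (R2 e x eR xe); rewrite mE xs orbT.
  - by move: len; rewrite !size_cat /= addnS.
have cycE : cycle_edges (s1 ++ z :: s2) = cycle_edges (z :: (s2 ++ s1)).
  by rewrite -(cycle_edges_rot (size s1) us) rot_size_cat.
have cycK : cycle_edges (s1 ++ s2) = cycle_edges (s2 ++ s1).
  by rewrite -(cycle_edges_rot (size s1) us12) rot_size_cat.
case rE : (s2 ++ s1) us' => [|y r] us'.
  by move: sz; rewrite size_cat addnC -size_cat rE.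
have r2 : 1 < size r by move: sz; rewrite size_cat addnC -size_cat rE.
have lr : [set last y r; y] \in cycle_edges (y :: r).
  rewrite cycle_edges_cons; last by case/andP: us'.
  by rewrite -cats1 pairmap_cat mem_cat /= inE eqxx orbT.
apply: (subdivision_step (x := last y r) (y := y) (z := z) IH); split.
- by rewrite /edges /= in_setU cycK rE lr.
- rewrite /verts /= in_setU negb_or zV inE andbT.
  have : z \notin s2 ++ s1 by rewrite rE; case/andP: us'.
  by rewrite !mem_cat orbC.
- by rewrite HV /verts /= setUA; congr (_ :|: V); apply/setP=> x;
    rewrite !inE mE.
rewrite HE cycE rE cycle_edges_insert // /edges /= cycK rE.
have lR : [set last y r; y] \notin R.
  apply/negP=> /R1/negP; apply; apply/subsetP=> x.
  have mr w : w \in y :: r -> w \in s1 ++ z :: s2.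
    by rewrite -rE mE !mem_cat => /orP[]->; rewrite ?orbT.
  by rewrite !inE => /orP[]/eqP->; apply: mr; rewrite ?mem_last ?mem_head.
apply/setP=> e; rewrite !inE; have [->|] := eqVneq e [set last y r; y].
  by rewrite (negPf lR) /= !orbF.
by rewrite /= !orbA.
Qed.

Lemma petersen_iso (g : bool * 'I_5 -> T) K : injective g ->
    verts K = [set g x | x : bool * 'I_5] ->
    edges K = [set g @: (e : {set bool * 'I_5}) | e in petersen_edges] ->
  isomorphic petersen K.
Proof.
move=> gI KV KE.
have gK (x : bool * 'I_5) : g x \in verts K by rewrite KV imset_f.
exists (fun x : {x | x \in verts petersen} =>
          exist (fun y => y \in verts K) (g (val x)) (gK (val x))).
  apply: inj_card_bij; last first.
    rewrite !card_sig [leqRHS](_ : _ = #|[set: bool * 'I_5]|) //.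
    by rewrite [leqLHS](_ : _ = #|verts K|) ?KV ?card_imset ?cardsT.
  by move=> x y [] /gI xy; apply: val_inj.
move=> x y /=; rewrite KE;
have -> : [set g (val x); g (val y)] = g @: [set val x; val y].
  by rewrite imsetU1 imset_set1.
by rewrite mem_imset //; apply: imset_inj.
Qed.

(** The second cycle visits the spokes in steps of two, as the inner pentagram
    does. *)
Lemma petersen_of_cycles (a0 a1 a2 a3 a4 b0 b1 b2 b3 b4 : T) K :
    uniq [:: a0; a1; a2; a3; a4; b0; b1; b2; b3; b4] ->
    verts K = [set x in [:: a0; a1; a2; a3; a4; b0; b1; b2; b3; b4]] ->
    edges K = cycle_edges [:: a0; a1; a2; a3; a4] :|:
      (cycle_edges [:: b0; b2; b4; b1; b3] :|:
      [set e in [:: [set a0; b0]; [set a1; b1]; [set a2; b2];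
                    [set a3; b3]; [set a4; b4]]]) ->
  isomorphic petersen K.
Proof.
move=> u KV KE.
pose l := [:: a0; a1; a2; a3; a4; b0; b1; b2; b3; b4].
pose g (x : bool * 'I_5) := nth a0 l (x.1 * 5 + x.2).
have lt10 (x : bool * 'I_5) : x.1 * 5 + x.2 < 10.
  by case: x => -[] [i hi] /=; lia.
apply: (@petersen_iso g).
- move=> x y /eqP; rewrite nth_uniq ?lt10 // => /eqP.
  case: x y => [b i] [c j] /= h; have := ltn_ord i; have := ltn_ord j.
  have bc : b = c.
    by have := ltn_ord i; have := ltn_ord j; move: h; case: b c => -[] /=; lia.
  by rewrite bc in h *; move=> _ _; congr pair; apply: val_inj => /=; lia.
- rewrite KV; apply/setP=> x; rewrite inE;
    apply/idP/imsetP => [/(nthP a0)[i hi <-] | [y _ ->]].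
    have h5 : i %% 5 < 5 by apply: ltn_pmod.
    exists (5 <= i, Ordinal h5) => //; rewrite /g /=; congr nth.
    by move: hi => /=; case: leqP; lia.
  by apply: mem_nth; apply: lt10.
have ua : uniq [:: a0; a1; a2; a3; a4].
  move: u; rewrite -[X in uniq X]/([:: a0; a1; a2; a3; a4] ++ _) cat_uniq.
  by case/andP.
have ub : uniq [:: b0; b2; b4; b1; b3].
  move: u; rewrite -[X in uniq X]/([:: a0; a1; a2; a3; a4] ++
                           [:: b0; b1; b2; b3; b4]) cat_uniq.
  case/and3P=> _ _ h; rewrite (@perm_uniq _ _ [:: b0; b1; b2; b3; b4]) //.
  by apply/permP=> p /=; lia.
rewrite KE; apply/setP=> e;
  rewrite !in_setU cycle_edges_cons // cycle_edges_cons //= !inE.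
have gE (x y : bool * 'I_5) : g @: [set x; y] = [set g x; g y].
  by rewrite imsetU1 imset_set1.
apply/idP/imsetP.
  pose i0 : 'I_5 := @Ordinal 5 0 isT. pose i1 : 'I_5 := @Ordinal 5 1 isT.
  pose i2 : 'I_5 := @Ordinal 5 2 isT. pose i3 : 'I_5 := @Ordinal 5 3 isT.
  pose i4 : 'I_5 := @Ordinal 5 4 isT.
  have ad (x y : bool * 'I_5) : petersen_adj x y ->
      exists2 e', e' \in petersen_edges & [set g x; g y] = g @: (e' : {set _}).
    move=> xy; exists [set x; y]; last by rewrite gE.
    by apply/imsetP; exists (x, y); rewrite ?inE.
  case/orP; [|case/orP].
  - case/or4P; [| | |case/orP]; move/eqP->.
    + exact: (ad (false, i0) (false, i1)).
    + exact: (ad (false, i1) (false, i2)).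
    + exact: (ad (false, i2) (false, i3)).
    + exact: (ad (false, i3) (false, i4)).
    + exact: (ad (false, i4) (false, i0)).
  - case/or4P; [| | |case/orP]; move/eqP->.
    + exact: (ad (true, i0) (true, i2)).
    + exact: (ad (true, i2) (true, i4)).
    + exact: (ad (true, i4) (true, i1)).
    + exact: (ad (true, i1) (true, i3)).
    + exact: (ad (true, i3) (true, i0)).
  - case/or4P; [| | |case/orP]; move/eqP->.
    + exact: (ad (false, i0) (true, i0)).
    + exact: (ad (false, i1) (true, i1)).
    + exact: (ad (false, i2) (true, i2)).
    + exact: (ad (false, i3) (true, i3)).
    + exact: (ad (false, i4) (true, i4)).
case=> _ /imsetP[[x y] + ->] ->; rewrite inE /= gE.
case: x y => [[] [[|[|[|[|[|//]]]]] hi]] [[] [[|[|[|[|[|//]]]]] hj]] //= _;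
  by rewrite /g /= eqxx ?orbT.
Qed.

End Cycles.

(** * Marked permutation graphs *)

Section Feet.
Variable T : finType.
Implicit Types (s t : seq T) (x y : T) (D e f : {set T}) (M F : {set {set T}})
  (G : graph T).

(** For an edge of M, which has a single end on the cycle s, this is the place
    of that end in s; the end itself is its foot. *)
Definition pos s e := find (fun x => x \in e) s.

Definition foot x0 s e := nth x0 s (pos s e).

(** M induces a bijection with the vertices of s. *)
Definition traverses M s : Prop :=
  [/\ uniq s, (forall e f x, e \in M -> f \in M -> x \in e -> x \in f -> e = f),
   {in s, forall x, exists2 e, e \in M & x \in e} &
   (forall e, e \in M -> exists2 x, x \in s & {in s, forall y, y \in e -> y = x}
     /\ x \in e)].

Section Side.
Variables (x0 : T) (M : {set {set T}}) (s : seq T).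
Hypothesis Ms : traverses M s.

Lemma pos_lt e : e \in M -> pos s e < size s.
Proof.
by case: Ms => _ _ _ h /h[x xs [_ xe]]; rewrite -has_find; apply/hasP; exists x.
Qed.

Lemma foot_mem e : e \in M -> foot x0 s e \in s.
Proof. by move=> /pos_lt; apply: mem_nth. Qed.

Lemma foot_in e : e \in M -> foot x0 s e \in e.
Proof.
by move=> /pos_lt h; apply: (@nth_find _ x0 (fun x => x \in e));
  rewrite has_find.
Qed.

Lemma index_foot e : e \in M -> index (foot x0 s e) s = pos s e.
Proof. by move=> /pos_lt h; case: Ms => us _ _ _; apply: index_uniq. Qed.

Lemma footP e x : e \in M -> x \in s -> x \in e -> x = foot x0 s e.
Proof.
move=> eM xs xe; case: Ms => _ _ _ /(_ e eM)[y ys [h _]].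
by rewrite (h x xs xe) (h _ (foot_mem eM) (foot_in eM)).
Qed.

Lemma foot_inj : {in M &, injective (foot x0 s)}.
Proof.
move=> e f eM fM h; case: Ms => _ /(_ e f (foot x0 s e) eM fM) h' _ _.
by apply: h'; [apply: foot_in | rewrite h; apply: foot_in].
Qed.

Lemma pos_inj : {in M &, injective (pos s)}.
Proof. by move=> e f eM fM h; apply: foot_inj => //; rewrite /foot h. Qed.

Lemma pos_onto k : k < size s -> exists2 e, e \in M & pos s e = k.
Proof.
move=> ks; case: Ms => us _ /(_ _ (mem_nth x0 ks))[e eM xe] _; exists e => //.
by rewrite -index_foot // -(footP eM (mem_nth x0 ks) xe) index_uniq.
Qed.

(** Every place of s is occupied by an end of an edge of M, so an empty arc has
    no room for any vertex of s. *)
Lemma neighbours_pos e f : e \in M -> f \in M -> neighbours M (pos s) e f ->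
  [set foot x0 s e; foot x0 s f] \in cycle_edges s.
Proof.
wlog H : e f / [forall z in M, ~~ cyc (pos s) e z f].
  move=> hw eM fM n; have /andP[_ /orP[h|h]] := n; first exact: hw.
  by rewrite setUC; apply: hw => //; rewrite neighbours_sym.
move=> eM fM /andP[ef _]; apply/imsetP; exists (foot x0 s e);
  first exact: foot_mem.
congr [set _; _]; have us : uniq s by case: Ms.
have pe := pos_lt eM; have pf := pos_lt fM.
have pef : pos s e != pos s f by apply: contra ef => /eqP h; apply/eqP/pos_inj.
have Hk k : k < size s ->
    ~~ [|| pos s e < k < pos s f, k < pos s f < pos s e
         | pos s f < pos s e < k].
  by move=> /pos_onto[z zM <-]; apply: (forall_inP H).
have -> : next s (foot x0 s e) =
    if (pos s e).+1 < size s then nth x0 s (pos s e).+1 else nth x0 s 0.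
  rewrite next_nth foot_mem // index_foot //.
  move: (pos s e) pe => k; clear; case: s => // y r;
    rewrite ltnS leq_eqVlt /= ltnS.
  by case: ltngtP => // [h|->] _;
    [apply: set_nth_default | rewrite nth_default].
rewrite /foot; have [h|h] := ltnP (pos s e).+1 (size s).
  suff -> : pos s f = (pos s e).+1 by [].
  by have := Hk _ h; move: pef; clear; lia.
suff -> : pos s f = 0 by [].
by have := Hk 0 (leq_ltn_trans (leq0n _) pe); move: h pe pf pef; clear; lia.
Qed.

(** Both sides are sorted by place in s and have the same elements. *)
Lemma filter_foot (xs : seq {set T}) D : {subset xs <= M} ->
    {in s, forall x, (x \in D) = (x \in map (foot x0 s) xs)} ->
    cyc_sorted (pos s) xs ->
  exists k, [seq x <- s | x \in D] = rot k (map (foot x0 s) xs).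
Proof.
move=> xM DE [k hk]; exists k; have us : uniq s by case: Ms.
have xM' e : e \in rot k xs -> e \in M by rewrite mem_rot => /xM.
pose r := relpre (index^~ s) ltn.
have tr : transitive r by move=> x y z; apply: ltn_trans.
apply: (@irr_sorted_eq _ r) => //.
- by move=> x; rewrite /= ltnn.
- apply: sorted_filter => //; rewrite -sorted_map.
  have -> : map (index^~ s) s = iota 0 (size s).
    apply: (@eq_from_nth _ 0); first by rewrite size_map size_iota.
    move=> i; rewrite size_map => hi.
    by rewrite (nth_map x0) // nth_iota // index_uniq.
  exact: iota_ltn_sorted.
- rewrite -map_rot sorted_map; apply: sub_in_sorted hk; last exact/allP/xM'.
  by move=> e f eM fM /=; rewrite !index_foot.
- move=> x; rewrite mem_filter mem_rot andbC.
  have [xs'|/negP xs'] := boolP (x \in s); first exact: DE.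
  apply/esym/negP=> /mapP[e /xM eM xe]; apply: xs'; rewrite xe; exact: foot_mem.
Qed.

End Side.

Lemma cyc_sorted_uniq (E : finType) (p : E -> nat) xs : cyc_sorted p xs ->
  uniq xs.
Proof.
case=> k; rewrite -(rot_uniq k); apply: sorted_uniq.
  by move=> x y z; apply: ltn_trans.
by move=> x; rewrite /= ltnn.
Qed.

Definition cycles_of G M s1 s2 : Prop :=
  [/\ [/\ traverses M s1, traverses M s2, 2 < size s1 & 2 < size s2],
      {in s1, forall x, x \notin s2},
      verts G = [set x in s1] :|: [set x in s2],
      edges G :\: M = cycle_edges s1 :|: cycle_edges s2 &
      M \subset edges G /\ {in M, forall e, #|e| = 2}].

(** An edge of M within one cycle would be a chord of it. *)
Lemma marked_cycles G M : marked_permutation_graph G M ->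
  partition M (verts G) /\ exists s1 s2, cycles_of G M s1 s2.
Proof.
case=> _ [ME Mpart] [C1 [C2 [[s1 [u1 z1 V1 E1]] [s2 [u2 z2 V2 E2]] [dis VG EG]
  ch1 ch2]]].
split=> //; exists s1, s2.
have s12 : {in s1, forall x, x \notin s2}.
  move=> x xs; have := disjointFr dis; rewrite V1 V2 => /(_ x).
  by rewrite !inE xs => /(_ isT)->.
have Ecard e : e \in M -> #|e| = 2.
  by move=> /(subsetP ME) eG;
    have /forall_inP/(_ e eG)/andP[/eqP] := graph_valP G.
have Ev e x : e \in M -> x \in e -> (x \in s1) || (x \in s2).
  move=> /(subsetP ME) eG xe;
    have /forall_inP/(_ e eG)/andP[_ /subsetP/(_ x xe)] := graph_valP G.
  by rewrite -/(verts G) -[verts G]/(verts (delete_edges G M)) VG V1 V2 !inE.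
have triv e f x : e \in M -> f \in M -> x \in e -> x \in f -> e = f.
  case/and3P: Mpart => _ /trivIsetP tI _ eM fM xe xf;
    apply/eqP/negPn/negP => ef.
  by have := disjointFr (tI e f eM fM ef) xe; rewrite xf.
have cov x : x \in s1 \/ x \in s2 -> exists2 e, e \in M & x \in e.
  move=> xs; have : x \in cover M.
    case/and3P: Mpart => /eqP -> _ _;
      rewrite -[verts G]/(verts (delete_edges G M)) VG V1 V2 !inE.
    by case: xs => ->; rewrite ?orbT.
  by case/bigcupP => e; exists e.
have cross C e : chordless G C -> edges C \subset edges G :\: M -> e \in M ->
    exists2 x, x \in e & x \notin verts C.
  move=> ch CE eM; apply/subsetPn; have := ch e;
    rewrite /is_chord (subsetP ME) //=.
  rewrite negb_and negbK => /orP[|//] /(subsetP CE); by rewrite inE eM.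
have sub1 : edges C1 \subset edges G :\: M.
  by rewrite -[_ :\: _]/(edges (delete_edges G M)) EG subsetUl.
have sub2 : edges C2 \subset edges G :\: M.
  by rewrite -[_ :\: _]/(edges (delete_edges G M)) EG subsetUr.
have ends e : e \in M -> exists x y, [/\ x \in s1, y \in s2 & e = [set x; y]].
  move=> eM; have [x xe] := cross C2 e ch2 sub2 eM;
    have [y ye] := cross C1 e ch1 sub1 eM.
  rewrite V1 V2 !inE => yn xn; have xs : x \in s1.
    by move: (Ev e x eM xe); rewrite (negPf xn) orbF.
  have ys : y \in s2 by move: (Ev e y eM ye); rewrite (negPf yn).
  exists x, y; split=> //; apply/esym/eqP; rewrite eqEcard Ecard // cards2.
  have -> : x != y by apply: contra xn => /eqP->.
  by rewrite leqnn andbT; apply/subsetP=> z; rewrite !inE => /orP[]/eqP->.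
split=> //.
- split=> //; split=> //.
  + by move=> x xs; apply: cov; left.
  + move=> e /ends[x [y [xs ys ->]]]; exists x; rewrite // !inE eqxx;
      split=> // z zs.
    by rewrite !inE => /orP[/eqP//|/eqP zy]; move: (s12 z zs); rewrite zy ys.
  + by move=> x xs; apply: cov; right.
  + move=> e /ends[x [y [xs ys ->]]]; exists y; rewrite // !inE eqxx orbT;
      split=> // z zs.
    by rewrite !inE => /orP[/eqP zx|/eqP//]; move: (s12 x xs); rewrite -zx zs.
- by rewrite -[verts G]/(verts (delete_edges G M)) VG V1 V2.
- by rewrite -[_ :\: _]/(edges (delete_edges G M)) EG E1 E2.
Qed.

(** The feet of two twins are consecutive on both cycles. *)
Lemma twins_C4 G M s1 s2 e f : cycles_of G M s1 s2 ->
    e \in M -> f \in M -> twins M (pos s1) (pos s2) e f ->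
  exists C, M_copy_C4 G M C.
Proof.
case=> [[M1 M2 z1 z2] s12 VG EG [ME Mcard]] eM fM /andP[n1 n2].
have x0 : T by case: (s1) z1.
pose a := foot x0 s1 e; pose b := foot x0 s1 f;
pose c := foot x0 s2 f; pose d := foot x0 s2 e.
have as1 : a \in s1 := foot_mem x0 M1 eM.
have bs1 : b \in s1 := foot_mem x0 M1 fM.
have cs2 : c \in s2 := foot_mem x0 M2 fM.
have ds2 : d \in s2 := foot_mem x0 M2 eM.
have ef : e != f by case/andP: n1.
have ne x y : x \in s1 -> y \in s2 -> x != y.
  by move=> /s12 xs ys; apply: contra xs => /eqP->.
have pair_eq g x y : g \in M -> x \in g -> y \in g -> x != y -> [set x; y] = g.
  move=> gM xg yg xy; apply/eqP; rewrite eqEcard Mcard // cards2 xy leqnn andbT.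
  by apply/subsetP=> z; rewrite !inE => /orP[]/eqP->.
have eE : [set d; a] = e.
  by apply: pair_eq; rewrite ?(foot_in _ M1) ?(foot_in _ M2) // eq_sym ne.
have fE : [set b; c] = f.
  by apply: pair_eq; rewrite ?(foot_in _ M1) ?(foot_in _ M2) // ne.
have ab : a != b by apply: contra ef => /eqP/(foot_inj M1) ->.
have cd : c != d by rewrite eq_sym; apply: contra ef => /eqP/(foot_inj M2) ->.
have u : uniq [:: a; b; c; d].
  by rewrite /= !inE !negb_or ab cd !ne.
have abE : [set a; b] \in edges G :\: M.
  by rewrite EG in_setU (neighbours_pos x0 M1).
have cdE : [set c; d] \in edges G :\: M.
  by rewrite EG in_setU [X in _ || X](neighbours_pos x0 M2) ?orbT //
    neighbours_sym.
have cE : cycle_edges [:: a; b; c; d] =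
    [set g in [:: [set a; b]; f; [set c; d]; e]].
  by apply/setP=> g; rewrite cycle_edges_cons //= [RHS]inE -eE -fE.
have Cax : graph_axiom ([set x in [:: a; b; c; d]],
                         cycle_edges [:: a; b; c; d]).
  by apply/forall_inP=> g; apply: cycle_edges_card2.
have Gab : ([set a; b] \in edges G) /\ [set a; b] \notin M.
  by apply/andP; rewrite andbC -in_setD.
have Gcd : ([set c; d] \in edges G) /\ [set c; d] \notin M.
  by apply/andP; rewrite andbC -in_setD.
exists (Graph Cax); split.
- rewrite /subgraph VG /verts /edges /= cE; apply/andP; split.
    by apply/subsetP=> x; rewrite !inE => /or4P[]/eqP->;
      rewrite ?as1 ?bs1 ?cs2 ?ds2 ?orbT.
  apply/subsetP=> g; rewrite !inE => /or4P[]/eqP->; first by case: Gab.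
  - exact: (subsetP ME).
  - by case: Gcd.
  - exact: (subsetP ME).
- by exists [:: a; b; c; d].
- by rewrite /verts /= cardsE; apply/card_uniqP.
- rewrite /edges /= cE.
  have -> : [set g in [:: [set a; b]; f; [set c; d]; e]] :&: M = [set e; f].
    apply/setP=> g; rewrite !inE; case: Gab Gcd => _ h1 [_ h2].
    apply/andP/orP => [[/or4P[]/eqP-> h] | [/eqP->|/eqP->]];
      rewrite ?eqxx ?orbT //; auto.
    + by rewrite h in h1.
    + by rewrite h in h2.
  by rewrite cards2 ef.
Qed.

Lemma two_cycles_axiom s t F : uniq s -> uniq t -> 1 < size s -> 1 < size t ->
    (forall e, e \in F -> (#|e| == 2) &&
      (e \subset [set x in s] :|: [set x in t])) ->
  graph_axiom ([set x in s] :|: [set x in t],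
               cycle_edges s :|: (cycle_edges t :|: F)).
Proof.
move=> us ut s1 t1 hF; apply/forall_inP=> e;
  rewrite !in_setU => /or3P[||/hF//] /cycle_edges_card2.
  by move=> /(_ us s1)/andP[-> h]; apply: subset_trans h (subsetUl _ _).
by move=> /(_ ut t1)/andP[-> h]; apply: subset_trans h (subsetUr _ _).
Qed.

Lemma cycle_edges_mem s e : e \in cycle_edges s ->
  e \subset [set x in s] /\ exists x, x \in e.
Proof.
move=> /imsetP[x xs ->]; split; last by exists x; rewrite !inE eqxx.
by apply/subsetP=> y; rewrite !inE => /orP[]/eqP->; rewrite ?mem_next.
Qed.

(** The cycles are subdivided one after the other; K is the graph in between,
    with the first cycle completed. *)
Lemma subdivide_both_cycles P D s1 s2 F H :
    uniq s1 -> uniq s2 -> {in s1, forall x, x \notin s2} ->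
    2 < size [seq x <- s1 | x \in D] -> 2 < size [seq x <- s2 | x \in D] ->
    (forall e, e \in F -> [/\ #|e| = 2, e \subset D,
       exists2 x, x \in e & x \in s1 & exists2 x, x \in e & x \in s2]) ->
    D \subset [set x in s1] :|: [set x in s2] ->
    verts P = D ->
    edges P = cycle_edges [seq x <- s1 | x \in D] :|:
      (cycle_edges [seq x <- s2 | x \in D] :|: F) ->
    verts H = [set x in s1] :|: [set x in s2] ->
    edges H = cycle_edges s1 :|: (cycle_edges s2 :|: F) ->
  subdivision P H.
Proof.
move=> u1 u2 s12 z1 z2 hF Ds VP EP VH EH.
pose t2 := [seq x <- s2 | x \in D].
have ut2 : uniq t2 by apply: filter_uniq.
have Z1 : 1 < size s1.
  by apply/ltnW/(leq_trans z1); rewrite size_filter count_size.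
have s21 x : x \in s2 -> x \notin s1.
  by move=> xs; apply/negP=> /s12; rewrite xs.
have t2s x : x \in t2 -> x \in s2 by rewrite mem_filter => /andP[].
have DE : D = [set x in [seq x <- s1 | x \in D]] :|: [set x in t2].
  apply/setP=> x; rewrite !inE !mem_filter -andb_orr.
  by case xD: (x \in D) => //; have := subsetP Ds x xD; rewrite !inE.
have Fs e x : e \in F -> x \in e -> x \in D by case/hF=> _ /subsetP h _ _ /h.
have Kax : graph_axiom ([set x in s1] :|: [set x in t2],
                         cycle_edges s1 :|: (cycle_edges t2 :|: F)).
  apply: two_cycles_axiom => //; first exact: ltnW.
  move=> e eF; have [-> _ _ _] := hF e eF; apply/subsetP=> x xe.
  have xD := Fs e x eF xe; have := subsetP Ds x xD; rewrite !inE mem_filter xD.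
  by [].
pose K := Graph Kax.
have PK : subdivision P K.
  apply: (@subdivide_cycle _ P P D [set x in t2] (cycle_edges t2 :|: F) s1) =>
    //.
  - rewrite disjoint_subset; apply/subsetP=> x; rewrite !inE => /t2s;
      exact: s21.
  - move=> e;
      rewrite in_setU =>
      /orP[/cycle_edges_mem[/subsetP et [x xe]]|/hF[_ _ _ [x xe xs]]];
      apply/subsetPn; exists x => //; rewrite inE; apply: s21 => //.
    by apply: t2s; have := et x xe; rewrite inE.
  - move=> e x;
      rewrite in_setU => /orP[/cycle_edges_mem[/subsetP et _]|eF] xe xs;
      last exact: Fs xe.
    by have := et x xe; rewrite inE mem_filter => /andP[].
  - exact: subdivision_refl.
  - by rewrite VP.
apply: (@subdivide_cycle _ K P D [set x in s1] (cycle_edges s1 :|: F) s2) => //.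
- rewrite disjoint_subset; apply/subsetP=> x; rewrite !inE; exact: s12.
- move=> e;
    rewrite in_setU =>
    /orP[/cycle_edges_mem[/subsetP et [x xe]]|/hF[_ _ [x xe xs] _]];
    apply/subsetPn; exists x => //; rewrite inE; apply: s12 => //.
  by have := et x xe; rewrite inE.
- move=> e x;
    rewrite in_setU => /orP[/cycle_edges_mem[/subsetP et _]|eF] xe xs;
    last exact: Fs xe.
  by have := et x xe; rewrite inE => /s12; rewrite xs.
- by rewrite /verts /= setUC.
- by rewrite /edges /= setUCA.
- by rewrite VH setUC.
- by rewrite EH setUCA.
Qed.

(** The feet of the five edges span a Petersen graph: with the first cycle as
    the outer pentagon, the second one becomes the pentagram.  The remaining
    vertices of the two cycles subdivide it. *)
Lemma pentagram_copy G M s1 s2 F : cycles_of G M s1 s2 ->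
    F \subset M -> pentagram F (pos s1) (pos s2) ->
  M_copy_P10 G M (delete_edges G (M :\: F)).
Proof.
move=> [[M1 M2 z1 z2] s12 VG EG [ME Mcard]] FM
  [y0 [y1 [y2 [y3 [y4 [FE so1 so2]]]]]].
have EH : edges (delete_edges G (M :\: F)) = edges (delete_edges G M) :|: F.
  apply/setP=> e; rewrite !inE; have [eF|eF] := boolP (e \in F).
    by rewrite (subsetP ME) ?(subsetP FM) // orbT.
  by rewrite orbF.
have uy := cyc_sorted_uniq so1.
have cF : #|F| = 5 by rewrite FE cardsE; apply/card_uniqP.
have yM : {subset [:: y0; y1; y2; y3; y4] <= M}.
  by move=> y hy; apply: (subsetP FM); rewrite FE inE.
split; last by exists F.
  by rewrite /subgraph subxx; apply: subsetDl.
have x0 : T by case: (s1) z1.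
pose a := foot x0 s1; pose b := foot x0 s2.
have aM e : e \in M -> a e \in s1 by exact: foot_mem.
have bM e : e \in M -> b e \in s2 by exact: foot_mem.
have eE e : e \in M -> e = [set a e; b e].
  move=> eM; apply/esym/eqP; rewrite eqEcard Mcard // cards2.
  have -> : a e != b e by apply: contraTN (bM e eM) => /eqP<-; apply/s12/aM.
  rewrite leqnn andbT; apply/subsetP=> z; rewrite !inE => /orP[]/eqP->.
    exact: (foot_in x0 M1).
  exact: (foot_in x0 M2).
pose la := map a [:: y0; y1; y2; y3; y4];
pose lb := map b [:: y0; y1; y2; y3; y4].
pose lb' := map b [:: y0; y2; y4; y1; y3].
have ula : uniq la.
  by rewrite map_inj_in_uniq // => e f /yM eM /yM fM; apply: (foot_inj M1).
have ulb : uniq lb.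
  by rewrite map_inj_in_uniq // => e f /yM eM /yM fM; apply: (foot_inj M2).
have la1 : {subset la <= s1} by move=> x /mapP[e /yM eM ->]; apply: aM.
have lb2 : {subset lb <= s2} by move=> x /mapP[e /yM eM ->]; apply: bM.
have ulab : uniq (la ++ lb).
  rewrite cat_uniq ula ulb andbT andTb; apply/hasPn=> x /lb2 xs2.
  by apply/negP=> /la1/s12; rewrite xs2.
pose D := [set x in la ++ lb].
have D1 : {in s1, forall x, (x \in D) = (x \in la)}.
  move=> x /s12 xs; rewrite inE mem_cat; case: (x \in la) => //=.
  by apply/negP=> /lb2; rewrite (negPf xs).
have D2 : {in s2, forall x, (x \in D) = (x \in lb)}.
  move=> x xs; rewrite inE mem_cat orbC; case: (x \in lb) => //=.
  by apply/negP=> /la1/s12; rewrite xs.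
have [k1 t1E] := filter_foot M1 yM D1 so1.
have plb : lb =i lb' by move=> x; rewrite !inE; do 5!case: eqP.
have ulb' : uniq lb'.
  by rewrite -(@perm_uniq _ lb) //; apply/permP=> P /=; clear; lia.
have [t2E z2D] : cycle_edges [seq x <- s2 | x \in D] = cycle_edges lb' /\
    size [seq x <- s2 | x \in D] = 5.
  case: so2 => so2.
    have [||k2 ->] := @filter_foot x0 _ _ M2 _ D _ _ so2.
    - by move=> y hy; apply: yM; move: hy; rewrite !inE; do 5!case: eqP.
    - by move=> x xs; rewrite D2 // plb.
    by rewrite cycle_edges_rot // size_rot.
  have sub (y : {set T}) : y \in [:: y0; y3; y1; y4; y2] -> y \in M.
    by move=> hy; apply: yM; move: hy; rewrite !inE; do 5!case: eqP.
  have [|k2 ->] := @filter_foot x0 _ _ M2 _ D sub _ so2.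
    by move=> x xs; rewrite D2 // !inE; do 5!case: eqP.
  split; last by rewrite size_rot.
  (* The other orientation of the same inner cycle. *)
  have -> : map (foot x0 s2) [:: y0; y3; y1; y4; y2] = rev (rot 1 lb') by [].
  have ur : uniq (rev (rot 1 lb')) by rewrite rev_uniq rot_uniq.
  by rewrite cycle_edges_rot // cycle_edges_rev ?rot_uniq // cycle_edges_rot.
have z1D : size [seq x <- s1 | x \in D] = 5 by rewrite t1E size_rot.
have t1E' : cycle_edges [seq x <- s1 | x \in D] = cycle_edges la.
  by rewrite t1E cycle_edges_rot.
have FD e : e \in F -> e \in M /\ e \subset D.
  rewrite FE inE => ey; have eM := yM e ey; split=> //.
  rewrite (eE e eM); apply/subsetP=> x;
    rewrite in_set2 [x \in D]inE mem_cat => /orP[]/eqP->.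
    by rewrite (map_f a ey).
  by rewrite (map_f b ey) orbT.
have Kax : graph_axiom ([set x in la] :|: [set x in lb'],
                         cycle_edges la :|: (cycle_edges lb' :|: F)).
  apply: two_cycles_axiom => // e /FD[eM eD]; rewrite Mcard // eqxx.
  apply: subset_trans eD _; apply/subsetP=> x; rewrite inE mem_cat !in_setU plb.
  by rewrite ![x \in [set _ in _]]inE.
have VK : verts (Graph Kax) = D.
  by apply/setP=> x; rewrite in_setU ![x \in [set _ in _]]inE mem_cat plb.
exists (Graph Kax).
  apply: (petersen_of_cycles ulab VK).
  rewrite /edges /=; congr (_ :|: (_ :|: _)).
  rewrite FE; apply/setP=> e; rewrite !inE.
  by rewrite -!eE //; apply: yM; rewrite !inE eqxx ?orbT.
apply: (@subdivide_both_cycles _ D s1 s2 F) => //.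
- by case: M1.
- by case: M2.
- by rewrite z1D.
- by rewrite z2D.
- move=> e /FD[eM eD]; split=> //; first exact: Mcard.
    by exists (a e); [apply: (foot_in x0 M1) | apply: aM].
  by exists (b e); [apply: (foot_in x0 M2) | apply: bM].
- apply/subsetP=> x; rewrite inE mem_cat in_setU ![x \in [set _ in _]]inE.
  by case/orP=> [/la1|/lb2] ->; rewrite ?orbT.
- by rewrite t1E' t2E.
- by rewrite EH -[edges (delete_edges G M)]/(edges G :\: M) EG setUA.
Qed.

End Feet.

Theorem proposition9 (T : finType) (G : graph T) (M : {set {set T}})
    (hGM : marked_permutation_graph G M) (hn : 40 <= #|verts G|)
    (hC4 : forall C : graph T, ~ M_copy_C4 G M C) :
  exists S : {set graph T},
    (forall H : graph T, H \in S -> M_copy_P10 G M H) /\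
    #|verts G| %/ 2 - 4 <= #|S|.
Proof.
have [Mpart [s1 [s2 hG]]] := marked_cycles hGM.
have [[M1 M2 z1 z2] _ _ _ [ME Mcard]] := hG.
have cM : #|verts G| %/ 2 = #|M|.
  by rewrite (card_uniform_partition Mcard Mpart) mulnK.
have x0 : T by case: (s1) z1.
have [e eM] : exists e, e \in M.
  by apply/card_gt0P; rewrite -cM divn_gt0 //; apply: leq_trans hn.
have pin : pinned M (pos s1) (pos s2) e.
  apply/pinnedP=> f g fM gM fg.
  by have [C /hC4] := twins_C4 hG fM gM fg.
have [S [hS cS]] := many_pentagrams (pos_inj x0 M1) (pos_inj x0 M2) eM pin.
exists [set delete_edges G (M :\: F) | F in S]; split.
  by move=> H /imsetP[F /hS[FM sF] ->]; apply: pentagram_copy hG FM sF.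
rewrite card_in_imset ?cM // =>
  F1 F2 /hS[F1M _] /hS[F2M _] /(congr1 (@edges T)) E.
have restr (F : {set {set T}}) :
    F \subset M -> edges (delete_edges G (M :\: F)) :&: M = F.
  move=> FM; apply/setP=> f; rewrite !inE negb_and negbK.
  have [fF|fF] := boolP (f \in F); first by rewrite (subsetP ME) ?(subsetP FM).
  by rewrite /=; case: (f \in M); rewrite // andbF.
by rewrite -(restr F1 F1M) -(restr F2 F2M) E.
Qed.
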